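(* Let $\lambda\ge 2$ and $\mu\ge 3$, and let $T_\lambda$ and $T_\mu$ be trees of diameter $\lambda$ and $\mu$ respectively. Let $n=|V(T_\lambda\times T_\mu)|$. Then $(T_\lambda\times T_\mu)(s_1,\dots,s_n)\in\mathscr{C}_0$ for all integers $s_1,\dots,s_n\ge 2$.
   Context: All graphs are finite and simple; $d(\cdot)$ denotes diameter. For a graph $G$ with vertex set $\{v_1,\dots,v_n\}$ and positive integers $s_1,\dots,s_n$, the vertex-multiplication $G(s_1,\dots,s_n)$ is the graph whose vertex set is a disjoint union $V_1\cup\dots\cup V_n$ with $|V_i|=s_i$, where $u\in V_i$ and $v\in V_j$ are adjacent iff $i\ne j$ and $v_iv_j\in E(G)$. For a connected bridgeless graph $X$, $\bar d(X)$ is the minimum diameter of a strong orientation of $X$. $\mathscr{C}_0$ is the class of all vertex-multiplications $G(s_1,\dots,s_n)$ of a connected graph $G$ with all $s_i\ge 2$ such that $\bar d(G(s_1,\dots,s_n))=d(G)$. The cartesian product $G\times H$ has vertex set $\{\langle u,x\rangle: u\in V(G), x\in V(H)\}$, with $\langle u,x\rangle\langle v,y\rangle$ an edge iff either $u=v$ and $xy\in E(H)$, or $uv\in E(G)$ and $x=y$. *)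

(* Defs.v *)
From HB Require Import structures.
From mathcomp Require Import all_boot.

Set Implicit Arguments.
Unset Strict Implicit.
Unset Printing Implicit Defensive.

Record sgraph := SGraph {
  vertex :> finType;
  adj : rel vertex;
  adj_sym : symmetric adj;
  adj_irrefl : irreflexive adj }.

(* Length of a shortest e-path from x to y. A shortest path has fewer than    *)
(* #|T| edges; the value is #|T| when y cannot be reached from x, so [diam]   *)
(* is the usual diameter only for connected graphs and strong digraphs.       *)
Definition dist (T : finType) (e : rel T) (x y : T) : nat :=
  find (fun k => [exists p : k.-tuple T, path e x p && (last x p == y)])
       (iota 0 #|T|).

Definition diam (T : finType) (e : rel T) : nat :=
  \max_(x : T) \max_(y : T) dist e x y.

Definition gdiam (G : sgraph) : nat := diam (@adj G).

Definition connected (G : sgraph) : Prop :=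
  0 < #|G| /\ forall x y : G, connect (@adj G) x y.

(* As a duplicate-free closed walk, an edge traversed back and forth is a     *)
(* [ucycle] of size 2; genuine cycles have size at least 3.                   *)
Definition acyclic (G : sgraph) : Prop :=
  forall c : seq G, ucycle (@adj G) c -> size c <= 2.

Definition tree (G : sgraph) : Prop := connected G /\ acyclic G.

Section CartesianProduct.
Variables G H : sgraph.

Definition cart_adj : rel (G * H) := fun a b =>
  ((a.1 == b.1) && adj a.2 b.2) || (adj a.1 b.1 && (a.2 == b.2)).

Lemma cart_adj_sym : symmetric cart_adj.
Proof.
by move=> a b; rewrite /cart_adj ![b.1 == _]eq_sym ![b.2 == _]eq_sym
  (adj_sym a.1) (adj_sym a.2).
Qed.

Lemma cart_adj_irrefl : irreflexive cart_adj.
Proof. by move=> a; rewrite /cart_adj !adj_irrefl andbF. Qed.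

Definition cart : sgraph := SGraph cart_adj_sym cart_adj_irrefl.

End CartesianProduct.

Section VertexMultiplication.
Variables (G : sgraph) (s : G -> nat).

(* The class V_v is the fibre of [tag] over v, of cardinal s v. The condition *)
(* that the classes be distinct is implied by irreflexivity of [adj].         *)
Definition vmul_adj : rel {v : G & 'I_(s v)} := fun a b =>
  adj (tag a) (tag b).

Lemma vmul_adj_sym : symmetric vmul_adj.
Proof. by move=> a b; rewrite /vmul_adj adj_sym. Qed.

Lemma vmul_adj_irrefl : irreflexive vmul_adj.
Proof. by move=> a; rewrite /vmul_adj adj_irrefl. Qed.

Definition vmul : sgraph := SGraph vmul_adj_sym vmul_adj_irrefl.

End VertexMultiplication.

(* Each edge xy is replaced by exactly one of the arcs (x, y) and (y, x).     *)
Definition orientation (X : sgraph) (D : rel X) : Prop :=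
  (forall x y, D x y -> adj x y) /\
  (forall x y, adj x y -> D x y (+) D y x).

Definition strong (T : finType) (D : rel T) : Prop :=
  forall x y, connect D x y.

(* [orient_diam X k]: strong orientations of X exist (X is connected and      *)
(* bridgeless) and the minimum of their diameters is k.                       *)
Definition orient_diam (X : sgraph) (k : nat) : Prop :=
  (exists D : rel X, [/\ orientation D, strong D & diam D = k]) /\
  (forall D : rel X, orientation D -> strong D -> k <= diam D).

Definition in_C0 (G : sgraph) (s : G -> nat) : Prop :=
  [/\ connected G, forall v, 2 <= s v & orient_diam (vmul s) (gdiam G)].

Arguments in_C0 G s : clear implicits.

(* Main.v *)
(** A walk in [G] lifts to the vertex-multiplication once each step [a -> b] is
    given a gain [c a b] in Z/2 with [c a b + c b a = 1]: orient the edge between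
    the copies [(a, i)] and [(b, j)] from the former to the latter iff
    [[0 < i] + c a b = [0 < j]], so that all copies [(a, i)] with [0 < i] are
    twins.  It then suffices to join any two vertices of the product by nonempty
    walks of length at most its diameter, of either total gain.  Traversing an edge
    back and forth changes the gain and costs two steps.  Proper 2-colourings of
    both trees provide a [c] for which the two ways around any unit square of the
    product have different gains, so no extra step is needed as soon as both
    coordinates have to change; otherwise two extra steps are affordable because
    both diameters are at least 2. *)

Require Import Defs.
From mathcomp Require Import all_boot zify.

Set Implicit Arguments.
Unset Strict Implicit.
Unset Printing Implicit Defensive.

(** * Shortest walks and diameter *)

Section Distance.
Variables (T : finType) (e : rel T).

Lemma dist_le_path x p : path e x p -> dist e x (last x p) <= size p.
Proof.
move=> xp; rewrite /dist; set P := fun k : nat => _.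
(* For a walk of [#|T|] or more edges the bound is automatic: [find] never exceeds the length of the
   list it searches. *)
have [lt_p|le_p] := ltnP (size p) #|T|; last first.
  by apply: leq_trans le_p; rewrite -[X in _ <= X](size_iota 0) find_size.
rewrite leqNgt; apply/negP => /(before_find 0).
rewrite nth_iota // add0n => /negbT/negP; apply; rewrite /P.
by apply/existsP; exists (in_tuple p); rewrite /= xp eqxx.
Qed.

Lemma dist_path x y : connect e x y ->
  exists p, [/\ path e x p, last x p = y & size p = dist e x y].
Proof.
case/connectP => p0 /shortenP[p xp uniq_p _] y_p.
(* A duplicate-free walk has fewer than [#|T|] edges, so [find] succeeds before reaching its default
   value. *)
have lt_p : size p < #|T|.
  by have := max_card (mem (x :: p)); rewrite (card_uniqP uniq_p).
rewrite /dist; set P := fun k : nat => _.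
have has_P : has P (iota 0 #|T|).
  apply/hasP; exists (size p); first by rewrite mem_iota.
  by rewrite /P; apply/existsP; exists (in_tuple p); rewrite /= xp y_p eqxx.
have := nth_find 0 has_P; move: has_P; rewrite has_find size_iota => lt_find.
rewrite nth_iota // add0n /P => /existsP[q /andP[xq /eqP lastq]].
by exists q; rewrite size_tuple.
Qed.

Lemma dist_le_diam x y : dist e x y <= diam e.
Proof.
apply: leq_trans (leq_bigmax (F := fun x => \max_y dist e x y) x).
exact: (leq_bigmax (F := dist e x)).
Qed.

Lemma diam_leP k : (forall x y, dist e x y <= k) -> diam e <= k.
Proof. by move=> le_k; apply/bigmax_leqP => x _; apply/bigmax_leqP. Qed.

Lemma diam_attained : 0 < #|T| -> exists x y, dist e x y = diam e.
Proof.
move=> T_gt0; have [x diam_x] := eq_bigmax (fun x => \max_y dist e x y) T_gt0.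
have [y diam_y] := eq_bigmax (dist e x) T_gt0.
by exists x, y; rewrite /diam diam_x.
Qed.

End Distance.

(** * Proper 2-colourings of trees *)

Section TwoColouring.
Variable G : sgraph.

Lemma not_uniq_split (T : eqType) (c : seq T) :
  ~~ uniq c -> exists x p q r, c = p ++ x :: q ++ x :: r.
Proof.
elim: c => //= y c IHc; rewrite negb_and negbK => /orP[/splitPr[q r]|].
  by exists y, [::], q, r.
by case/IHc => x [p] [q] [r] ->; exists x, (y :: p), q, r.
Qed.

(** Strong induction on the length. A duplicate-free closed walk has size at most 2 by acyclicity,
    and size 1 would be a loop. *)
Lemma acyclic_even_cycle (c : seq G) :
  acyclic G -> cycle (@adj G) c -> ~~ odd (size c).
Proof.
move=> acycG; have [n] := ubnP (size c).
elim: n c => // n IHn c lt_c_n cyc_c.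
have [uniq_c|] := boolP (uniq c).
  have : size c <= 2 by apply: acycG; apply/andP.
  by case: c cyc_c {uniq_c lt_c_n} => [|x [|y [|z c]]] //=; rewrite adj_irrefl.
(* A repeated vertex splits the closed walk into two shorter ones. *)
case/not_uniq_split => x [p] [q] [r] def_c.
move: cyc_c lt_c_n; rewrite {}def_c cycle_catC /= -catA rcons_cat cat_path /=.
rewrite rcons_path /= => /and3P[xq qx xrp].
rewrite !size_cat /= size_cat /= => lt_n.
have cyc_q : cycle (@adj G) (x :: q) by rewrite /= rcons_path xq.
have cyc_rp : cycle (@adj G) (x :: r ++ p) by rewrite /= rcons_path.
have := IHn _ _ cyc_q; have := IHn _ _ cyc_rp; rewrite /= size_cat; lia.
Qed.

(** Colour a vertex by the parity of a chosen walk from a root. For adjacent [u] and [v], the two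
    chosen walks and the edge form a closed walk, whose even length forces different parities. *)
Lemma tree_2colouring :
  tree G -> exists col : G -> bool, forall u v, adj u v -> col v = ~~ col u.
Proof.
move=> [[/card_gt0P[r _] connG] acycG].
have walk u : exists p, path (@adj G) r p && (last r p == u).
  by have /connectP[p rp ->] := connG r u; exists p; rewrite rp eqxx.
exists (fun u => odd (size (xchoose (walk u)))) => u v uv.
have /andP[] := xchooseP (walk u); have /andP[] := xchooseP (walk v).
move: (xchoose _) (xchoose _) => p q rq /eqP last_q rp /eqP last_p.
have rev_q : path (@adj G) v (rev (belast r q)).
  rewrite -last_q rev_path (eq_path (e' := @adj G)) // => x y.
  exact: adj_sym.
(* Out along [p] to [u], across to [v], back along [q]; [belast] drops the final [r], since [cycle]
   itself returns to its first vertex. *)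
have : cycle (@adj G) (r :: p ++ belast v (rev (belast r q))).
  rewrite /= rcons_cat cat_path rp last_p.
  have -> : rcons (belast v (rev (belast r q))) r = v :: rev (belast r q).
    rewrite [RHS]lastI; congr rcons.
    by case: q {rq rev_q} last_q => //= y q _; rewrite rev_cons last_rcons.
  by rewrite /= uv.
move/(acyclic_even_cycle acycG).
rewrite /= size_cat size_belast size_rev size_belast oddD.
by case: (odd _); case: (odd _).
Qed.

End TwoColouring.

(** * Orienting the vertex-multiplication by gains *)

Section Lifting.
Variables (G : sgraph) (s : G -> nat) (c : rel G).
Hypothesis s_ge2 : forall v, 2 <= s v.
Hypothesis c_antisym : forall a b, adj a b -> c b a = ~~ c a b.

Definition lift_arc : rel (vmul s) := fun x y =>
  adj (tag x) (tag y) &&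
  ((0 < tagged x) (+) c (tag x) (tag y) == (0 < tagged y)).

Fixpoint gain (a : G) (p : seq G) : bool :=
  if p is b :: p' then c a b (+) gain b p' else false.

Lemma lift_arc_orientation : orientation lift_arc.
Proof.
split=> x y; first by case/andP.
rewrite /vertex /= /vmul_adj /lift_arc => xy.
rewrite (adj_sym (tag y)) xy (c_antisym xy) /=.
by case: (c _ _); case: (0 < _); case: (0 < _).
Qed.

(** The copies at inner vertices can be chosen freely, so each is taken to fit the arc entering it.
    Only the last copy is prescribed, and the total gain makes the last arc fit; hence the induction
    starts at walks with one edge. *)
Lemma lift_walk (x y : vmul s) p :
    path (@adj G) (tag x) p -> last (tag x) p = tag y -> 0 < size p ->
    gain (tag x) p = (0 < tagged x) (+) (0 < tagged y) ->
  exists q, [/\ path lift_arc x q, last x q = y & size q = size p].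
Proof.
elim: p x => // b [|b' p] IHp x; rewrite [path _ _ _]/= => /andP[xb bp].
  move=> /= def_b _; rewrite addbF => gain_x; exists [:: y]; split=> //=.
  rewrite /lift_arc; move: xb gain_x; rewrite def_b => -> -> /=.
  by case: (0 < _); case: (0 < _).
move=> last_p _ gain_x.
(* Read as a number, [k] is the index 0 or 1 of the next copy; both exist as [s b] is at least 2. *)
pose k := (0 < tagged x) (+) c (tag x) b.
have lt_k : k < s b by apply: leq_trans (s_ge2 b); case: k.
pose z : vmul s := Tagged (fun v => 'I_(s v)) (Ordinal lt_k).
have def_k : (0 < tagged z) = k by rewrite /=; case: k {lt_k z}.
have [||||q [zq last_q size_q]] := IHp z => //.
  by rewrite def_k /k [_ (+) c _ _]addbC -addbA -gain_x; apply/esym/addKb.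
exists (z :: q); split=> //=; last by rewrite size_q.
by rewrite zq /lift_arc def_k xb eqxx.
Qed.

Lemma connect_dist_lift (x y : vmul s) p k :
    path (@adj G) (tag x) p -> last (tag x) p = tag y -> 0 < size p <= k ->
    gain (tag x) p = (0 < tagged x) (+) (0 < tagged y) ->
  connect lift_arc x y /\ dist lift_arc x y <= k.
Proof.
move=> xp last_p /andP[p_gt0 le_p_k] gain_p.
have [q [xq <- size_q]] := lift_walk xp last_p p_gt0 gain_p.
split; first by apply/connectP; exists q.
by apply: leq_trans (dist_le_path xq) _; rewrite size_q.
Qed.

End Lifting.

(** A directed path projects under [tag] to a walk of the same length in [G]; apply this to copies
    of two vertices at maximal distance. *)
Lemma gdiam_le_orientation (G : sgraph) (s : G -> nat) (D : rel (vmul s)) :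
    0 < #|G| -> (forall v, 0 < s v) -> orientation D -> strong D ->
  gdiam G <= diam D.
Proof.
move=> G_gt0 s_gt0 [D_adj _] strongD.
have [a [b]] := diam_attained (@adj G) G_gt0; rewrite /gdiam => <-.
pose copy v : vmul s := Tagged (fun v => 'I_(s v)) (Ordinal (s_gt0 v)).
have [p [ap last_p size_p]] := dist_path (strongD (copy a) (copy b)).
apply: leq_trans (dist_le_diam D (copy a) (copy b)); rewrite -size_p.
have -> : b = last a (map tag p) by rewrite -[a]/(tag (copy a)) last_map last_p.
rewrite -(size_map tag p); apply: dist_le_path.
rewrite -[a]/(tag (copy a)) path_map; apply: sub_path ap => x y; exact: D_adj.
Qed.

Lemma in_C0_gain (G : sgraph) (s : G -> nat) (c : rel G) :
    connected G -> (forall v, 2 <= s v) ->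
    (forall a b, adj a b -> c b a = ~~ c a b) ->
    (forall a b g, exists p, [/\ path (@adj G) a p, last a p = b,
       0 < size p <= gdiam G & gain c a p = g]) ->
  in_C0 G s.
Proof.
move=> connG s_ge2 c_antisym walks; have [G_gt0 _] := connG.
have s_gt0 v : 0 < s v := ltnW (s_ge2 v).
have liftP x y :
    connect (lift_arc c) x y /\ dist (lift_arc (s := s) c) x y <= gdiam G.
  have [p [xp last_p size_p gain_p]] :=
    walks (tag x) (tag y) ((0 < tagged x) (+) (0 < tagged y)).
  exact: connect_dist_lift xp last_p size_p gain_p.
have strong_lift : strong (lift_arc (s := s) c).
  by move=> x y; case: (liftP x y).
have orient_lift := lift_arc_orientation s c_antisym.
split=> //; split; last by move=> D; apply: gdiam_le_orientation.
exists (lift_arc c); split=> //; apply/eqP; rewrite eqn_leq.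
rewrite (gdiam_le_orientation G_gt0 s_gt0 orient_lift strong_lift) andbT.
by apply: diam_leP => x y; case: (liftP x y).
Qed.

Lemma connected_adj (G : sgraph) :
  connected G -> 0 < gdiam G -> forall u : G, exists v, adj u v.
Proof.
move=> [G_gt0 connG] diam_gt0 u.
have [v [w]] := diam_attained (@adj G) G_gt0; rewrite -/(gdiam G) => dist_vw.
have [z neq_z] : exists z, z != u.
  have [def_v|] := eqVneq v u; last by exists v.
  exists w; apply: contraTneq diam_gt0 => def_w; rewrite -dist_vw def_v def_w.
  rewrite -leqNgt.
  exact: (dist_le_path (e := @adj G) (x := u) (p := [::])).
have /connectP[[|v' p] /= up def_z] := connG u z.
  by rewrite def_z eqxx in neq_z.
by exists v'; case/andP: up.
Qed.

(** * Walks of both gains in a product of 2-coloured graphs *)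

Section Product.
Variables G H : sgraph.
Local Notation GH := (cart G H).

Lemma cart_path_proj (a : GH) p : path (@adj GH) a p ->
  exists q r, [/\ path (@adj G) a.1 q /\ last a.1 q = (last a p).1,
    path (@adj H) a.2 r /\ last a.2 r = (last a p).2
    & size q + size r = size p].
Proof.
elim: p a => [|b p IHp] a /=; first by exists [::], [::].
case/andP=> ab /IHp[q [r [[bq last_q] [br last_r] <-]]].
case/orP: ab => /andP[].
  move=> /eqP-> ab; exists q, (b.2 :: r); rewrite /= ab br addnS; by split.
move=> ab /eqP->; exists (b.1 :: q), r; rewrite /= ab bq; by split.
Qed.

Lemma cart_path_l u x p :
  path (@adj G) u p -> path (@adj GH) (u, x) (map (pair^~ x) p).
Proof.
apply: (homo_path (f := pair^~ x)) => v w vw.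
by rewrite /= /cart_adj /= vw eqxx orbT.
Qed.

Lemma cart_path_r u x p :
  path (@adj H) x p -> path (@adj GH) (u, x) (map (pair u) p).
Proof.
apply: (homo_path (f := pair u)) => v w vw.
by rewrite /= /cart_adj /= vw eqxx.
Qed.

Lemma cart_connected : connected G -> connected H -> connected GH.
Proof.
move=> [G_gt0 connG] [H_gt0 connH]; split.
  by rewrite card_prod muln_gt0 G_gt0.
move=> [u x] [v y].
have /connectP[p up ->] := connG u v; have /connectP[q xq ->] := connH x y.
apply/connectP; exists (map (pair^~ x) p ++ map (pair (last u p)) q).
  by rewrite cat_path cart_path_l // (last_map (pair^~ x)) cart_path_r.
by rewrite last_cat (last_map (pair^~ x)) (last_map (pair _)).
Qed.

(** Each step of a walk changes one coordinate, so the lengths of its two projections add up to its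
    own. *)
Lemma cart_gdiam_ge :
  connected G -> connected H -> gdiam G + gdiam H <= gdiam GH.
Proof.
move=> connG connH; have [_ connGH] := cart_connected connG connH.
have [u [v]] := diam_attained (@adj G) (proj1 connG).
have [x [y]] := diam_attained (@adj H) (proj1 connH).
rewrite /gdiam => <- <-.
have [p [ap last_p size_p]] := dist_path (connGH (u, x) (v, y)).
apply: leq_trans (dist_le_diam _ (u, x) (v, y)); rewrite -size_p.
have [q [r [[uq last_q] [xr last_r] <-]]] := cart_path_proj ap.
move: last_q last_r; rewrite last_p /= => <- <-.
by rewrite leq_add ?dist_le_path.
Qed.

Variables (colG : G -> bool) (colH : H -> bool).
Hypothesis colGP : forall u v, adj u v -> colG v = ~~ colG u.
Hypothesis colHP : forall x y, adj x y -> colH y = ~~ colH x.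

(** The gain is [colG] plus [colH] at the start of a [G]-edge, and [colH] alone at the start of an
    [H]-edge. Reversing an edge flips exactly one of these colours. In a unit square, parallel
    [H]-edges have equal gains and parallel [G]-edges opposite ones. *)
Definition cart_gain : rel GH := fun a b =>
  ((a.2 == b.2) && colG a.1) (+) colH a.2.

Lemma cart_gain_antisym a b : adj a b -> cart_gain b a = ~~ cart_gain a b.
Proof.
rewrite /cart_gain => /orP[] /andP[].
  move=> _ ab; rewrite (colHP ab) [b.2 == _]eq_sym.
  by case: eqP ab => // ->; rewrite adj_irrefl.
by move=> ab /eqP->; rewrite eqxx (colGP ab) /= addNb.
Qed.

Lemma gain_back_forth a b p : adj a b ->
  gain cart_gain a [:: b, a & p] = ~~ gain cart_gain a p.
Proof. by move=> ab /=; rewrite (cart_gain_antisym ab) addbA addbN addbb. Qed.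

Lemma gain_square u v x y p : adj u v -> adj x y ->
  gain cart_gain (u, x) [:: (u, y), (v, y) & p] =
  ~~ gain cart_gain (u, x) [:: (v, x), (v, y) & p].
Proof.
move=> uv xy; have neq_xy : (x == y) = false.
  by apply/eqP => def_x; rewrite def_x adj_irrefl in xy.
rewrite /= /cart_gain /= neq_xy !eqxx (colHP xy) /=.
by case: (colG u); case: (colH x); case: (gain _ _ _).
Qed.

Lemma cart_walks (a b : GH) g :
    connected G -> connected H -> 2 <= gdiam G -> 2 <= gdiam H ->
  exists p, [/\ path (@adj GH) a p, last a p = b,
    0 < size p <= gdiam GH & gain cart_gain a p = g].
Proof.
move: a b => [u x] [v y] connG connH G_ge2 H_ge2.
have le_diam := cart_gdiam_ge connG connH.
have [q [uq last_q size_q]] := dist_path (proj2 connG u v).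
have [r [xr last_r size_r]] := dist_path (proj2 connH x y).
have := dist_le_diam (@adj G) u v; have := dist_le_diam (@adj H) x y.
rewrite -size_q -size_r -!/(gdiam _) => le_r le_q.
have [w uw] := connected_adj connG (ltnW G_ge2) u.
have adj_ux : adj ((u, x) : GH) (w, x) by rewrite /= /cart_adj /= uw eqxx orbT.
have adj_wx : adj ((w, x) : GH) (u, x) by rewrite adj_sym.
have path_detour p : path (@adj GH) (u, x) p ->
    path (@adj GH) (u, x) [:: (w, x), (u, x) & p].
  by move=> up; apply/and3P.
(* One detour corrects a wrong gain. Two detours preserve a correct gain and make an empty walk
   nonempty, at the price of length 4. *)
have detour p : path (@adj GH) (u, x) p -> last (u, x) p = (v, y) ->
    (size p).+2 <= gdiam GH -> 0 < size p \/ 4 <= gdiam GH ->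
  exists p, [/\ path (@adj GH) (u, x) p, last (u, x) p = (v, y),
    0 < size p <= gdiam GH & gain cart_gain (u, x) p = g].
  move=> up last_p le_p p_or.
  have [gain_p|gain_p] := eqVneq (gain cart_gain (u, x) p) g; last first.
    exists [:: (w, x), (u, x) & p]; rewrite path_detour // gain_back_forth //.
    by split=> //; move: gain_p; case: gain; case: g.
  have [p_gt0|p_le0] := ltnP 0 (size p).
    by exists p; split=> //; rewrite p_gt0 ltnW // ltnW.
  have le4_p : (size p).+4 <= gdiam GH by lia.
  exists [:: (w, x), (u, x), (w, x), (u, x) & p].
  rewrite !path_detour // !gain_back_forth // negbK.
  by split.
pose p := map (pair^~ x) q ++ map (pair v) r.
have up : path (@adj GH) (u, x) p.
  by rewrite cat_path cart_path_l // (last_map (pair^~ x)) last_q cart_path_r.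
have last_p : last (u, x) p = (v, y).
  by rewrite last_cat (last_map (pair^~ x)) last_q (last_map (pair v)) last_r.
have size_p : size p = size q + size r by rewrite size_cat !size_map.
(* If one coordinate stays fixed, the diameter of its factor, at least 2, pays for a detour; if both
   do, the two diameters together allow length 4. *)
have [r0|r_gt0] := posnP (size r).
  by apply: (detour p); rewrite ?size_p //; lia.
have [q0|q_gt0] := posnP (size q).
  by apply: (detour p); rewrite ?size_p //; lia.
clear p up last_p size_p.
case: q uq last_q q_gt0 le_q {size_q} => // u' q.
move=> /andP[uu' u'q] /= last_q _ le_q.
case: r xr last_r r_gt0 le_r {size_r} => // x' r.
move=> /andP[xx' x'r] /= last_r _ le_r.
(* The walk goes through three corners of the unit square [u u'] x [x x'], and
   can use either of the two remaining corners. *)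
pose rest := map (pair^~ x') q ++ map (pair v) r.
have path_rest : path (@adj GH) (u', x') rest.
  by rewrite cat_path cart_path_l // (last_map (pair^~ x')) last_q cart_path_r.
have last_rest : last (u', x') rest = (v, y).
  by rewrite last_cat (last_map (pair^~ x')) last_q (last_map (pair v)) last_r.
have le_rest : (size rest).+2 <= gdiam GH.
  by rewrite /rest size_cat !size_map; lia.
have path_via z : adj ((u, x) : GH) z -> adj (z : GH) (u', x') ->
  path (@adj GH) (u, x) [:: z, (u', x') & rest].
  by move=> az zb; apply/and3P.
have via_ux' : path (@adj GH) (u, x) [:: (u, x'), (u', x') & rest].
  by apply: path_via; rewrite /= /cart_adj /= ?uu' ?xx' eqxx ?orbT.
have via_u'x : path (@adj GH) (u, x) [:: (u', x), (u', x') & rest].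
  by apply: path_via; rewrite /= /cart_adj /= ?uu' ?xx' eqxx ?orbT.
have := gain_square rest uu' xx'.
have [<-|neq_g gain_ux'] :=
    eqVneq (gain cart_gain (u, x) [:: (u', x), (u', x') & rest]) g.
  by exists [:: (u', x), (u', x') & rest]; split.
by exists [:: (u, x'), (u', x') & rest]; split=> //;
  rewrite gain_ux'; move: neq_g; case: gain; case: (g).
Qed.

End Product.

Theorem theorem1p7 (lambda mu : nat) (lambda_ge2 : 2 <= lambda) (mu_ge3 : 3 <= mu)
  (Tl Tm : sgraph) (Tl_tree : tree Tl) (Tm_tree : tree Tm)
  (Tl_diam : gdiam Tl = lambda) (Tm_diam : gdiam Tm = mu)
  (s : cart Tl Tm -> nat) (s_ge2 : forall v : cart Tl Tm, 2 <= s v) :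
  in_C0 (cart Tl Tm) s.
Proof.
have [connl _] := Tl_tree; have [connm _] := Tm_tree.
have [coll collP] := tree_2colouring Tl_tree.
have [colm colmP] := tree_2colouring Tm_tree.
apply: (in_C0_gain (c := cart_gain coll colm)) => //.
- exact: cart_connected.
- exact: cart_gain_antisym.
- by move=> a b g; apply: cart_walks => //; rewrite ?Tl_diam ?Tm_diam // ltnW.
Qed.
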